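(* Let $n\ge 2$ be an integer, let $f=(f_1,\ldots,f_n)$ be a sequence of symbols with degrees $|f|=(|f_1|,\ldots,|f_n|)\in\mathbb{Z}^n$, and let $\mathcal{E}_f$ be the set of permutations of $f$. The Koszul sign map $\kappa:S_n\times\mathcal{E}_f\to\{\pm1\}$ defined in the context is the unique map $S_n\times\mathcal{E}_f\to\{\pm1\}$ such that 1. for all $\sigma,\tau\in S_n$ and all $g\in\mathcal{E}_f$, $\kappa(\sigma\tau,g)=\kappa(\sigma,\tau(g))\,\kappa(\tau,g)$; 2. for all $i\in\{1,\ldots,n-1\}$ and all $g\in\mathcal{E}_f$, $\kappa(s_i,g)=(-1)^{|g_i||g_{i+1}|}$, where $s_i$ denotes the transposition $(i,i+1)$.
   Context: Symbols are elements of a set in which each element $s$ is assigned a degree $|s|\in\mathbb{Z}$. Fix $n\ge2$ and a sequence of symbols $f=(f_1,\ldots,f_n)$. The set of permutations of $f$ is $$\mathcal{E}_f=\{g=(g_1,\ldots,g_n)\,:\,\exists\rho\in S_n,\ g_i=f_{\rho^{-1}(i)}\text{ for } i=1,\ldots,n\},$$ where $S_n$ is the group of permutations of $\{1,\ldots,n\}$; accordingly $|g_i|=|f_{\rho^{-1}(i)}|$. The group $S_n$ acts on the left on $\mathcal{E}_f$ by $\sigma(g)=(g_{\sigma^{-1}(1)},\ldots,g_{\sigma^{-1}(n)})$. Let $F_{n-1}$ be the free group on generators $s_1,\ldots,s_{n-1}$, with unit $e$, acting on $\mathcal{E}_f$ on the left by $$s_i(g)=s_i^{-1}(g)=(g_1,\ldots,g_{i-1},g_{i+1},g_i,g_{i+2},\ldots,g_n).$$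 Define $\kappa:F_{n-1}\times\mathcal{E}_f\to\{\pm1\}$ by $\kappa(e,g)=1$; $\kappa(s_i,g)=\kappa(s_i^{-1},g)=(-1)^{|g_i||g_{i+1}|}$ for $1\le i\le n-1$; and, if $x=t_{i_1}\cdots t_{i_m}$ is the reduced form of $x\in F_{n-1}$ (each $t_{i_j}$ is $s_{i_j}$ or $s_{i_j}^{-1}$, with no two consecutive factors inverse to each other), $$\kappa(x,g)=\kappa(t_{i_1},t_{i_2}\cdots t_{i_m}(g))\,\kappa(t_{i_2},t_{i_3}\cdots t_{i_m}(g))\cdots\kappa(t_{i_m},g).$$ For each $g$, the value $\kappa(x,g)$ depends only on the image of $x$ under the surjective morphism $F_{n-1}\to S_n$, $s_i\mapsto(i,i+1)$. The Koszul sign map $\kappa:S_n\times\mathcal{E}_f\to\{\pm1\}$ is the resulting induced map. *)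

(* Defs.v *)
From mathcomp Require Import all_boot all_order all_algebra all_fingroup zify.

Set Implicit Arguments.
Unset Strict Implicit.
Unset Printing Implicit Defensive.

Import Order.TTheory GRing.Theory Num.Theory.
Local Open Scope ring_scope.

(* Positions 1, ..., n are 'I_n = {0, ..., n-1}; the index set {1, ..., n-1} of
   the generators s_i is 'I_n.-1, and the generator of index i exchanges the
   positions fstpos i and sndpos i, that is i and i+1. *)

Lemma sndpos_subproof n (i : 'I_n.-1) : (i.+1 < n)%N.
Proof. by rewrite -ltn_predRL. Qed.

Definition fstpos n (i : 'I_n.-1) : 'I_n := widen_ord (leq_pred n) i.
Definition sndpos n (i : 'I_n.-1) : 'I_n := Ordinal (sndpos_subproof i).

Definition adj_tperm n (i : 'I_n.-1) : 'S_n := tperm (fstpos i) (sndpos i).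

(* The product (s * t)%g of the library applies s first; this is the usual
   composition, which applies t first. *)
Definition perm_comp n (s t : 'S_n) : 'S_n := (t * s)%g.

(* The set E_f of permutations of f. *)

Definition is_permutation_of n (S : Type) (f g : {ffun 'I_n -> S}) : Prop :=
  exists rho : 'S_n, forall i, g i = f ((rho^-1)%g i).

Definition permutations_of n (S : Type) (f : {ffun 'I_n -> S}) : Type :=
  {g : {ffun 'I_n -> S} | is_permutation_of f g}.

Lemma perm_act_subproof n (S : Type) (f : {ffun 'I_n -> S}) (s : 'S_n)
    (g : permutations_of f) :
  is_permutation_of f [ffun i => sval g ((s^-1)%g i)].
Proof.
case: g => g /= [rho gE]; exists (perm_comp s rho) => i.
by rewrite ffunE gE /perm_comp invMg permM.
Qed.

Definition perm_act n (S : Type) (f : {ffun 'I_n -> S}) (s : 'S_n)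
    (g : permutations_of f) : permutations_of f :=
  exist _ [ffun i => sval g ((s^-1)%g i)] (perm_act_subproof s g).

Lemma gen_act_subproof n (S : Type) (f : {ffun 'I_n -> S}) (i : 'I_n.-1)
    (g : permutations_of f) :
  is_permutation_of f [ffun k => sval g (adj_tperm i k)].
Proof.
case: g => g /= [rho gE]; exists (perm_comp (adj_tperm i) rho) => k.
by rewrite ffunE gE /perm_comp invMg permM tpermV.
Qed.

Definition gen_act n (S : Type) (f : {ffun 'I_n -> S}) (i : 'I_n.-1)
    (g : permutations_of f) : permutations_of f :=
  exist _ [ffun k => sval g (adj_tperm i k)] (gen_act_subproof i g).

(* The free group F_{n-1}, each element being given by its reduced form: the
   letter (i, false) is s_i and (i, true) is its inverse.  The word t_1 ... t_m
   is the sequence [:: t_1; ...; t_m]. *)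

Definition letter n : Type := ('I_n.-1 * bool)%type.

Definition inverse_letters n (t u : letter n) : bool :=
  (t.1 == u.1) && (t.2 != u.2).

Definition reduced n (w : seq (letter n)) : bool :=
  sorted (fun t u => ~~ inverse_letters t u) w.

Definition free_group n := {w : seq (letter n) | reduced w}.

Definition word_act n (S : Type) (f : {ffun 'I_n -> S}) (w : seq (letter n))
    (g : permutations_of f) : permutations_of f :=
  foldr (fun t h => gen_act t.1 h) g w.

Definition word_perm n (w : seq (letter n)) : 'S_n :=
  foldr (fun t s => perm_comp (adj_tperm t.1) s) 1%g w.

Definition free_perm n (x : free_group n) : 'S_n := word_perm (val x).

(* The exponent of (-1) is an integer, possibly negative. *)
Definition gen_sign n (S : Type) (deg : S -> int) (f : {ffun 'I_n -> S})
    (i : 'I_n.-1) (g : permutations_of f) : int :=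
  (-1) ^ (deg (sval g (fstpos i)) * deg (sval g (sndpos i))).

Fixpoint word_sign n (S : Type) (deg : S -> int) (f : {ffun 'I_n -> S})
    (w : seq (letter n)) (g : permutations_of f) : int :=
  if w is t :: w' then gen_sign deg t.1 (word_act w' g) * word_sign deg w' g
  else 1.

Definition free_sign n (S : Type) (deg : S -> int) (f : {ffun 'I_n -> S})
    (x : free_group n) (g : permutations_of f) : int :=
  word_sign deg (val x) g.

(* Surjectivity of free_perm. *)

Lemma word_perm_cat n (v w : seq (letter n)) :
  word_perm (v ++ w) = perm_comp (word_perm v) (word_perm w).
Proof.
rewrite /perm_comp; elim: v => [|t v IHv] /=; first by rewrite mulg1.
by rewrite IHv /perm_comp mulgA.
Qed.

Definition posw n (l : seq 'I_n.-1) : seq (letter n) :=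
  [seq (i, false) | i <- l].

Lemma reduced_posw n (l : seq 'I_n.-1) : reduced (posw l).
Proof.
rewrite /reduced; case: l => //= i l.
elim: l i => //= j l IHl i; rewrite IHl andbT.
by rewrite /inverse_letters /= andbF.
Qed.

Lemma tperm_posw n (x y : 'I_n) :
  exists l : seq 'I_n.-1, word_perm (posw l) = tperm x y.
Proof.
wlog le_xy : x y / (x <= y)%N => [IH|].
  by case: (leqP x y) => [/IH //|/ltnW/IH]; rewrite tpermC.
case: y le_xy => y; elim: y => [|y IHy] lt_yn /=; rewrite ?leqn0.
  move=> /eqP x0; exists [::]; have -> : x = Ordinal lt_yn by apply: val_inj.
  by rewrite tperm1.
rewrite leq_eqVlt => /orP[/eqP x_y|].
  exists [::]; have -> : x = Ordinal lt_yn by apply: val_inj.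
  by rewrite tperm1.
have lt_yn1 : (y < n.-1)%N by rewrite ltn_predRL.
pose i := Ordinal lt_yn1.
have -> : Ordinal lt_yn = sndpos i by apply: val_inj.
rewrite ltnS leq_eqVlt => /orP[/eqP x_y|lt_xy].
  exists [:: i]; rewrite /= /perm_comp mul1g /adj_tperm.
  by congr tperm; apply: val_inj.
have [l lE] := IHy (ltnW lt_yn) (ltnW lt_xy).
exists (i :: l ++ [:: i]).
rewrite /= /posw map_cat word_perm_cat -/(posw l) lE /= /perm_comp mul1g.
have -> : Ordinal (ltnW lt_yn) = fstpos i by apply: val_inj.
have n1 : x != fstpos i by rewrite -val_eqE /= neq_ltn lt_xy.
have n2 : x != sndpos i by rewrite -val_eqE /= neq_ltn ltnS ltnW.
rewrite -[X in (X * _ * _)%g]tpermV -mulgA -conjgE tpermJ /adj_tperm.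
by rewrite tpermL tpermD // eq_sym.
Qed.

Lemma free_perm_surj n (s : 'S_n) : exists x : free_group n, free_perm x == s.
Proof.
suff [l lE] : exists l, word_perm (@posw n l) = s.
  by exists (Sub (posw l) (reduced_posw l)); rewrite /free_perm /= lE.
have [ts -> _] := prod_tpermP s.
elim: ts => [|t ts [l lE]]; first by exists [::]; rewrite big_nil.
have [l' l'E] := tperm_posw t.1 t.2.
exists (l ++ l').
by rewrite /posw map_cat word_perm_cat /perm_comp lE l'E big_cons.
Qed.

(* The Koszul sign map: free_sign at any lift of s; koszul_free_perm below
   shows that the choice of the lift does not matter. *)
Definition koszul n (S : Type) (deg : S -> int) (f : {ffun 'I_n -> S})
    (s : 'S_n) (g : permutations_of f) : int :=
  free_sign deg (xchoose (free_perm_surj s)) g.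

Arguments koszul {n S} deg f s g.

(* Independence of the lift, from the expression of the sign of a word as a
   product over the inversions of its permutation. *)

Definition inv_sign n (s : 'S_n) (d : 'I_n -> int) : int :=
  \prod_(p : 'I_n * 'I_n | (p.1 < p.2)%N && (s p.2 < s p.1)%N)
     (-1) ^ (d p.1 * d p.2).

Lemma sign_sqr (a : int) : ((-1) ^ a * (-1) ^ a : int) = 1.
Proof. by rewrite -exprzMl ?unitrN1 ?mulrNN ?mulr1 ?exp1rz. Qed.

Lemma adj_tperm_lt n (i : 'I_n.-1) (x y : 'I_n) : x != y ->
  ~~ ((x == fstpos i) && (y == sndpos i)) ->
  ~~ ((x == sndpos i) && (y == fstpos i)) ->
  (adj_tperm i x < adj_tperm i y)%N = (x < y)%N.
Proof.
rewrite /adj_tperm; case: (tpermP _ _ x) => [->|->|/eqP + /eqP];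
  case: (tpermP _ _ y) => [->|->|/eqP + /eqP]; rewrite -!val_eqE /=; lia.
Qed.

Lemma inv_sign_step n (i : 'I_n.-1) (s : 'S_n) (d : 'I_n -> int) :
  inv_sign (perm_comp (adj_tperm i) s) d =
  (-1) ^ (d ((s^-1)%g (fstpos i)) * d ((s^-1)%g (sndpos i))) * inv_sign s d.
Proof.
rewrite /inv_sign /perm_comp.
set a := (s^-1)%g _; set b := (s^-1)%g _.
have sa : s a = fstpos i by rewrite permKV.
have sb : s b = sndpos i by rewrite permKV.
have nab : val a != val b.
  apply/eqP => /val_inj ab.
  by move: (congr1 val sb); rewrite -ab sa /=; lia.
pose q := if (a < b)%N then (a, b) else (b, a).
rewrite [LHS]big_mkcond [in RHS]big_mkcond.
rewrite [LHS](bigD1 q) //= [in RHS](bigD1 q) //= mulrA; congr (_ * _).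
  rewrite /q; case: (boolP (a < b)%N) => ab /=;
    rewrite !permM sa sb /adj_tperm tpermL tpermR /=.
    by rewrite ab ltnSn ltnNge leqnSn mulr1.
  have -> : (b < a)%N by rewrite ltn_neqAle eq_sym nab leqNgt.
  by rewrite ltnSn ltnNge leqnSn /= [d a * _]mulrC sign_sqr.
apply: eq_bigr => -[x y] /= nq; rewrite !permM.
case: ltnP => //= lt_xy; rewrite adj_tperm_lt //.
- by rewrite (inj_eq perm_inj) -val_eqE /=; lia.
- apply: contra nq; rewrite -sa -sb !(inj_eq perm_inj) => /andP[/eqP ya /eqP xb].
  have -> : q = (b, a) by rewrite /q -ya -xb ltnNge ltnW.
  by rewrite ya xb.
- apply: contra nq; rewrite -sa -sb !(inj_eq perm_inj) => /andP[/eqP yb /eqP xa].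
  have -> : q = (a, b) by rewrite /q -yb -xa lt_xy.
  by rewrite yb xa.
Qed.

Lemma word_actE n (S : Type) (f : {ffun 'I_n -> S}) (w : seq (letter n))
    (g : permutations_of f) (k : 'I_n) :
  sval (word_act w g) k = sval g (((word_perm w)^-1)%g k).
Proof.
elim: w k => [|t w IHw] k /=; first by rewrite invg1 perm1.
by rewrite ffunE IHw /perm_comp invMg permM tpermV.
Qed.

Lemma word_signE n (S : Type) (deg : S -> int) (f : {ffun 'I_n -> S})
    (w : seq (letter n)) (g : permutations_of f) :
  word_sign deg w g = inv_sign (word_perm w) (fun k => deg (sval g k)).
Proof.
elim: w => [|t w IHw] /=.
  rewrite /inv_sign big_pred0 // => p; rewrite !perm1.
  by case: ltnP => //= /ltnW; rewrite leqNgt => /negbTE.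
by rewrite inv_sign_step IHw /gen_sign !word_actE.
Qed.

Lemma koszul_free_perm n (S : Type) (deg : S -> int) (f : {ffun 'I_n -> S})
    (x : free_group n) (g : permutations_of f) :
  koszul deg f (free_perm x) g = free_sign deg x g.
Proof.
rewrite /koszul /free_sign !word_signE; congr inv_sign.
exact/eqP/(xchooseP (free_perm_surj (free_perm x))).
Qed.

(* Maps S_n x E_f -> {+1, -1} are integer-valued maps with values +1 and -1. *)
Definition sign_valued (A B : Type) (k : A -> B -> int) : Prop :=
  forall a b, k a b = 1 \/ k a b = -1.

Definition sign_cocycle n (S : Type) (f : {ffun 'I_n -> S})
    (k : 'S_n -> permutations_of f -> int) : Prop :=
  forall (s t : 'S_n) (g : permutations_of f),
    k (perm_comp s t) g = k s (perm_act t g) * k t g.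

Definition sign_on_adjacent n (S : Type) (deg : S -> int)
    (f : {ffun 'I_n -> S}) (k : 'S_n -> permutations_of f -> int) : Prop :=
  forall (i : 'I_n.-1) (g : permutations_of f),
    k (adj_tperm i) g =
    (-1) ^ (deg (sval g (fstpos i)) * deg (sval g (sndpos i))).

(* Main.v *)
(** Every permutation is the image of a word in the adjacent transpositions, and
    the Koszul sign of that image is the sign of the word.  Concatenation of
    words gives the cocycle identity.  Conversely, a map satisfying 1 and 2 is
    computed on any word by peeling off one letter at a time; it is trivial at
    the identity because s_1 s_1 = 1. *)
Require Import Defs.
From mathcomp Require Import all_boot all_order all_algebra all_fingroup.

Import GRing.Theory.
Local Open Scope ring_scope.

(** Reducedness is dropped so that words can be concatenated freely. *)
Lemma word_perm_surj {n} (s : 'S_n) : exists w : seq (letter n), word_perm w = s.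
Proof. by have [x /eqP <-] := free_perm_surj s; exists (val x). Qed.

(** The lift chosen in [koszul] maps to [s], and the sign of a word sees only the inversions of its
    permutation. *)
Lemma koszulE n (S : Type) (deg : S -> int) (f : {ffun 'I_n -> S})
    (s : 'S_n) (g : permutations_of f) :
  koszul deg f s g = inv_sign s (fun k => deg (sval g k)).
Proof.
rewrite /koszul /free_sign word_signE; congr inv_sign.
exact/eqP/(xchooseP (free_perm_surj s)).
Qed.

Lemma koszul_word_perm n (S : Type) (deg : S -> int) (f : {ffun 'I_n -> S})
    (w : seq (letter n)) (g : permutations_of f) :
  koszul deg f (word_perm w) g = word_sign deg w g.
Proof. by rewrite koszulE word_signE. Qed.

Lemma eq_inv_sign n (s : 'S_n) (d e : 'I_n -> int) :
  d =1 e -> inv_sign s d = inv_sign s e.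
Proof. by move=> de; rewrite /inv_sign; apply: eq_bigr => p _; rewrite !de. Qed.

Lemma word_act_cat n (S : Type) (f : {ffun 'I_n -> S}) (v w : seq (letter n))
    (g : permutations_of f) :
  word_act (v ++ w) g = word_act v (word_act w g).
Proof. exact: foldr_cat. Qed.

Lemma word_sign_cat n (S : Type) (deg : S -> int) (f : {ffun 'I_n -> S})
    (v w : seq (letter n)) (g : permutations_of f) :
  word_sign deg (v ++ w) g =
  word_sign deg v (word_act w g) * word_sign deg w g.
Proof.
elim: v => [|t v IHv] /=; first by rewrite mul1r.
by rewrite IHv word_act_cat mulrA.
Qed.

(** The exponent may be negative; the power squares to 1 in an integral domain, so it is 1 or -1. *)
Lemma exprN1z_cases (a : int) : (-1) ^ a = 1 :> int \/ (-1) ^ a = -1 :> int.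
Proof.
have /eqP := sign_sqr a; rewrite -expr2 sqrf_eq1.
by case/orP => /eqP ->; [left | right].
Qed.

Lemma koszul_sign_valued n (S : Type) (deg : S -> int) (f : {ffun 'I_n -> S}) :
  sign_valued (koszul deg f).
Proof.
move=> s g; have [w <-] := word_perm_surj s; rewrite koszul_word_perm.
elim: w => [|t w IHw] /=; first by left.
rewrite /gen_sign; set a := _ * deg _.
by case: (exprN1z_cases a) => ->; case: IHw => ->; rewrite ?mulrNN ?mul1r ?mulr1; auto.
Qed.

Lemma koszul_sign_cocycle n (S : Type) (deg : S -> int) (f : {ffun 'I_n -> S}) :
  sign_cocycle (koszul deg f).
Proof.
move=> s t g.
have [v <-] := word_perm_surj s; have [w <-] := word_perm_surj t.
rewrite -word_perm_cat !koszul_word_perm word_sign_cat !word_signE.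
(* [word_act w g] and [perm_act (word_perm w) g] may differ in their membership proofs; the
   inversion product only needs their degrees, which agree pointwise. *)
by congr (_ * _); apply: eq_inv_sign => k; rewrite word_actE /= ffunE.
Qed.

Lemma koszul_on_adjacent n (S : Type) (deg : S -> int) (f : {ffun 'I_n -> S}) :
  sign_on_adjacent deg (koszul deg f).
Proof.
move=> i g; have -> : adj_tperm i = word_perm [:: (i, false)].
  by rewrite /= /perm_comp mul1g.
by rewrite koszul_word_perm /= mulr1.
Qed.

(* [perm_act 1 g] and [g] carry different membership proofs, so the cocycle
   identity at (1, 1) only gives [k 1 (perm_act 1 g) = 1]; writing 1 as the
   square of a transposition reduces to degrees and avoids proof irrelevance. *)
Lemma sign_cocycle1 n (S : Type) (deg : S -> int) (f : {ffun 'I_n -> S})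
    (k : 'S_n -> permutations_of f -> int) (g : permutations_of f) :
  (2 <= n)%N -> sign_cocycle k -> sign_on_adjacent deg k -> k 1%g g = 1.
Proof.
move=> n_ge2 kM kadj.
have n1_gt0 : (0 < n.-1)%N by rewrite ltn_predRL.
pose i := Ordinal n1_gt0.
have -> : 1%g = perm_comp (adj_tperm i) (adj_tperm i) by rewrite /perm_comp tperm2.
rewrite kM !kadj /= !ffunE tpermV tpermL tpermR.
by rewrite [X in _ ^ X * _]mulrC sign_sqr.
Qed.

Lemma sign_cocycle_word_perm n (S : Type) (deg : S -> int)
    (f : {ffun 'I_n -> S}) (k : 'S_n -> permutations_of f -> int)
    (w : seq (letter n)) (g : permutations_of f) :
  (2 <= n)%N -> sign_cocycle k -> sign_on_adjacent deg k ->
  k (word_perm w) g = word_sign deg w g.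
Proof.
move=> n_ge2 kM kadj; elim: w => [|t w IHw] /=; first exact: (sign_cocycle1 _ _ deg).
(* The value of [k] on a generator depends only on entries, and those of [perm_act (word_perm w) g]
   and [word_act w g] coincide. *)
by rewrite kM kadj IHw /gen_sign !word_actE /= !ffunE.
Qed.

Theorem proposition2p3 (n : nat) (S : Type) (deg : S -> int)
    (f : {ffun 'I_n -> S}) (hn : (2 <= n)%N) :
  [/\ sign_valued (koszul deg f),
      sign_cocycle (koszul deg f),
      sign_on_adjacent deg (koszul deg f)
    & forall k : 'S_n -> permutations_of f -> int,
        sign_valued k -> sign_cocycle k -> sign_on_adjacent deg k ->
        forall (s : 'S_n) (g : permutations_of f), k s g = koszul deg f s g].
Proof.
split; [exact: koszul_sign_valued | exact: koszul_sign_cocycle |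
        exact: koszul_on_adjacent |].
move=> k _ kM kadj s g; have [w <-] := word_perm_surj s.
by rewrite koszul_word_perm; apply: sign_cocycle_word_perm.
Qed.
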